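(* Let $n$ be a positive integer and $\mathfrak{g}=A_{n-1}^+$. There exist elements $f_m\in\mathfrak{g}^*$ such that $\dim\Omega_{f_m}=2m$, for each (i) $m=0,1,2,3,\dots,\frac14(n-2)n$ if $n$ is even; (ii) $m=0,1,2,3,\dots,\frac14(n-1)^2$ if $n$ is odd.
   Context: $A_{n-1}^+$ is the Lie algebra of strictly upper triangular $n\times n$ complex matrices. The group $G=\exp(\mathfrak{g})$ of unitriangular $n\times n$ complex matrices acts on $\mathfrak{g}^*$ by the coadjoint action $(g.f)(x)=f(g^{-1}xg)$. For $f\in\mathfrak{g}^*$, $\Omega_f$ denotes the $G$-orbit (coadjoint orbit) of $f$; its dimension (as an algebraic variety) equals $\dim\mathfrak{g}-\dim\mathfrak{g}^f$, where $\mathfrak{g}^f=\{x\in\mathfrak{g}: f([x,y])=0\ \forall y\in\mathfrak{g}\}$. *)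

(* Defs.v *)
From HB Require Import structures.
From mathcomp Require Import all_boot all_order all_algebra.
From mathcomp Require Import reals complex mpoly.

Set Implicit Arguments.
Unset Strict Implicit.
Unset Printing Implicit Defensive.

Import GRing.Theory.
Local Open Scope ring_scope.

Section StrictlyUpper.
Variables (K : fieldType) (n : nat).

Definition strictly_upper : {vspace 'M[K]_n} :=
  (\sum_(i < n) \sum_(j < n | (i < j)%N) <[delta_mx i j]>)%VS.

Lemma strictly_upperP (x : 'M[K]_n) :
  reflect (forall i j : 'I_n, (j <= i)%N -> x i j = 0) (x \in strictly_upper).
Proof.
apply: (iffP idP) => [|x0].
  rewrite /strictly_upper; elim/big_ind: _ x => [x|U V HU HV x|i _ x].
  - by rewrite memv0 => /eqP-> i j _; rewrite mxE.
  - case/memv_addP=> u uU [v vV ->] i j le_ji.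
    by rewrite mxE HU // HV // addr0.
  elim/big_ind: _ x => [x|U V HU HV x|j lt_ij x].
  - by rewrite memv0 => /eqP-> k l _; rewrite mxE.
  - case/memv_addP=> u uU [v vV ->] k l le_lk.
    by rewrite mxE HU // HV // addr0.
  case/vlineP=> a -> k l le_lk; rewrite !mxE.
  case: andP => [[/eqP ki /eqP lj]|_]; last by rewrite mulr0.
  by move: le_lk; rewrite ki lj leqNgt lt_ij.
rewrite [x]matrix_sum_delta; apply: memv_sumr => i _.
rewrite (bigID (fun j : 'I_n => (i < j)%N)) /= [X in _ + X]big1 ?addr0.
  by apply: memv_sumr => j _; apply: memvZ; apply: memv_line.
by move=> j; rewrite -leqNgt => /x0->; rewrite scale0r.
Qed.

Definition unitriangular (u : 'M[K]_n) : Prop :=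
  forall i j : 'I_n, (j <= i)%N -> u i j = (i == j)%:R.

(* [vsproj] plays no role beyond a type cast: by [conj_strictly_upper] its
   argument lies in [strictly_upper] when [u] is unitriangular. *)
Definition coadjoint (u : 'M[K]_n) (f : 'Hom(subvs_of strictly_upper, K^o)) :
    'Hom(subvs_of strictly_upper, K^o) :=
  linfun (fun x => f (vsproj strictly_upper (invmx u *m vsval x *m u))).

Definition coadjoint_orbit (f h : 'Hom(subvs_of strictly_upper, K^o)) : Prop :=
  exists2 u : 'M[K]_n, unitriangular u & h = coadjoint u f.

Lemma unitriangular_unit (u : 'M[K]_n) : unitriangular u -> u \in unitmx.
Proof.
move=> uu; rewrite unitmxE -det_tr det_trig.
  rewrite big1 ?unitr1 // => i _; by rewrite mxE uu ?eqxx.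
apply/is_trig_mxP => i j lt_ij; rewrite mxE uu; last exact: ltnW.
by case: eqP lt_ij => // ->; rewrite ltnn.
Qed.

Lemma strictly_upper_mulr (x u : 'M[K]_n) :
  unitriangular u -> x \in strictly_upper -> x *m u \in strictly_upper.
Proof.
move=> uu /strictly_upperP x0; apply/strictly_upperP => i j le_ji.
rewrite mxE big1 // => k _; have [le_ki|lt_ik] := leqP k i.
  by rewrite x0 ?mul0r.
have lt_jk := leq_ltn_trans le_ji lt_ik.
by rewrite uu ?(ltnW lt_jk) // -val_eqE gtn_eqF ?mulr0.
Qed.

Lemma strictly_upper_mull (x u : 'M[K]_n) :
  unitriangular u -> x \in strictly_upper -> u *m x \in strictly_upper.
Proof.
move=> uu /strictly_upperP x0; apply/strictly_upperP => i j le_ji.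
rewrite mxE big1 // => k _; have [le_jk|lt_kj] := leqP j k.
  by rewrite x0 ?mulr0.
have lt_ki := leq_trans lt_kj le_ji.
by rewrite uu ?(ltnW lt_ki) // -val_eqE gtn_eqF ?mul0r.
Qed.

Lemma conj_strictly_upper (u x : 'M[K]_n) :
  unitriangular u -> x \in strictly_upper ->
  invmx u *m x *m u \in strictly_upper.
Proof.
move=> uu xg; apply: strictly_upper_mulr => //.
pose L : 'End('M[K]_n) := linfun (mulmx u).
have Lsub : (L @: strictly_upper <= strictly_upper)%VS.
  apply/subvP=> _ /memv_imgP[y yg ->]; rewrite lfunE /=.
  exact: strictly_upper_mull.
have uU := unitriangular_unit uu.
have L0 : lker L == 0%VS.
  apply/lker0P => y z; rewrite !lfunE /= => /(congr1 (mulmx (invmx u))).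
  by rewrite !mulKmx.
have /eqP eqL : (L @: strictly_upper == strictly_upper)%VS.
  by rewrite eqEdim Lsub /= limg_dim_eq // (eqP L0) capv0.
move: xg; rewrite -{1}eqL => /memv_imgP[y yg ->].
by rewrite lfunE /= mulKmx.
Qed.

Lemma coadjointE (u : 'M[K]_n) f x :
  coadjoint u f x =
  f (vsproj strictly_upper (invmx u *m vsval x *m u)).
Proof.
pose F (y : subvs_of strictly_upper) : K^o :=
  f (vsproj strictly_upper (invmx u *m vsval y *m u)).
have F_lin : linear F.
  move=> a y z; rewrite /F.
  have -> : vsval (a *: y + z) = a *: vsval y + vsval z by [].
  rewrite mulmxDr mulmxDl -scalemxAr -scalemxAl.
  by rewrite !linearP.
pose Fl : {linear subvs_of strictly_upper -> K^o} :=
  HB.pack F (GRing.isLinear.Build _ _ _ _ F F_lin).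
exact: (lfunE Fl x).
Qed.

End StrictlyUpper.

Section VarietyDimension.
Variables (K : fieldType) (V : vectType K).

Definition polyfun (p : {mpoly K[\dim {:V}]}) (v : V) : K :=
  p.@[fun i => coord (vbasis {:V}) i v].

(* The restrictions to [X] of the polynomial functions [p i] are algebraically
   independent over [K]. *)
Definition alg_indep_on (X : V -> Prop) (d : nat)
    (p : 'I_d -> {mpoly K[\dim {:V}]}) : Prop :=
  forall q : {mpoly K[d]},
    (forall v, X v -> q.@[fun i => polyfun (p i) v] = 0) -> q = 0.

(* The dimension of [X] (equivalently, of its Zariski closure) as an algebraic
   variety: the maximal number of algebraically independent elements of the
   coordinate ring, i.e. of the ring of polynomial functions restricted to [X].
   No [d] satisfies this when [X] is empty. *)
Definition has_variety_dim (X : V -> Prop) (d : nat) : Prop :=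
  (exists p : 'I_d -> {mpoly K[\dim {:V}]}, alg_indep_on X p) /\
  (forall (e : nat) (p : 'I_e -> {mpoly K[\dim {:V}]}),
     alg_indep_on X p -> (e <= d)%N).

End VarietyDimension.

(* Main.v *)
From HB Require Import structures.
Require Import Defs.
From mathcomp Require Import all_boot all_order all_algebra.
From mathcomp Require Import reals complex mpoly zify.

Set Implicit Arguments.
Unset Strict Implicit.
Unset Printing Implicit Defensive.

Import GRing.Theory.
Local Open Scope ring_scope.

(** Identify a functional with a strictly lower triangular matrix G through
    x |-> tr (G x); only the entries of G below the diagonal matter, and the
    coadjoint action of u sends G to u G u^-1. The functionals used come from
    nested rook placements: positions (c k, s k), for k < r, with s increasing,
    c decreasing and s k < c k, where G has entries 1, all other entries being
    0. The orbit of such a functional has dimension 2 * \sum_k (c k - s k - 1).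
    The outermost rooks (n-1, 0), (n-2, 1), ... contribute n-2, n-4, ... to the
    half dimension, and the arm of one further rook, nested inside them, can have
    any length that fits; so the half dimension takes all values up to
    (n-2) + (n-4) + ..., which is the integer part of (n-1)^2 / 4.

    The rook matrix is a product A0 B0, where column k of A0 is the basis vector
    at c k and row k of B0 the one at s k; its conjugates are the products
    (u A0) (B0 u^-1). Column k of u A0 ends with a 1 at row c k, and row k of
    B0 u^-1 starts with a 1 at column s k. Conversely every product A B of
    matrices of these shapes lies in the orbit, modulo entries on or above the
    diagonal (rook_orbit_factor). Below the diagonal, A B involves only
    the entries of column k of A and row k of B strictly between s k and c k, so
    the orbit is the image of a polynomial map in 2 * \sum_k (c k - s k - 1)
    parameters (factor_param). In the other direction, the entries of A B in the
    positions (i, s k) and (c k, i) with s k < i < c k take arbitrary values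
    (rook_coords_onto), because the equations for A and B are triangular in k.

    These two facts give the dimension (has_variety_dim_param): coordinates that
    map the orbit onto an affine space over an infinite field are algebraically
    independent on it (mpoly_vanish_eq0), and d + 1 polynomials in d parameters
    are always algebraically dependent (mpoly_dependent). *)

(** * Polynomials in several variables *)

Lemma digits_inj (N n : nat) (f g : nat -> nat) :
  (forall i, i < n -> f i < N)%N -> (forall i, i < n -> g i < N)%N ->
  (\sum_(i < n) f i * N ^ i = \sum_(i < n) g i * N ^ i)%N ->
  forall i, (i < n)%N -> f i = g i.
Proof.
elim: n f g => [|n IHn] f g fN gN //.
have E (h : nat -> nat) : (\sum_(i < n.+1) h i * N ^ i =
            (\sum_(i < n) h i.+1 * N ^ i) * N + h 0)%N.
  rewrite big_ord_recl muln1 addnC big_distrl; congr (_ + _)%N.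
  by apply: eq_bigr => i _; rewrite expnSr mulnA.
have N_gt0 : (0 < N)%N by apply: leq_ltn_trans (fN 0%N _).
rewrite !E => eq_fg.
have eq0 : f 0%N = g 0%N.
  by have := congr1 (modn^~ N) eq_fg; rewrite /= !modnMDl !modn_small ?fN ?gN.
move: eq_fg; rewrite eq0 => /addIn/eqP; rewrite eqn_pmul2r // => /eqP eqS.
move=> [|i] lt_in //.
by apply: (IHn (f \o succn) (g \o succn)) => // j lt_jn /=; [apply: fN|apply: gN].
Qed.

(** Kronecker's substitution: evaluating the i-th variable at y ^+ (N ^ i), with N
    above all exponents of p, gives a univariate polynomial in y with the same
    coefficients, as monomials are read off the base N digits of exponents. The
    injection x provides infinitely many roots. *)
Lemma mpoly_vanish_eq0 (K : idomainType) (x : nat -> K) (n : nat)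
    (p : {mpoly K[n]}) :
  injective x -> (forall v, p.@[v] = 0) -> p = 0.
Proof.
move=> x_inj p0; pose N := msize p.
(* The exponent of the univariate polynomial at which the monomial m ends up. *)
pose code (m : 'X_{1..n}) := (\sum_(i < n) m i * N ^ i)%N.
pose P := \sum_(m <- msupp p) p@_m *: 'X^(code m).
have P0 : P = 0.
  apply: (@roots_geq_poly_eq0 _ _ [seq x i | i <- iota 0 (size P)]).
  - apply/allP=> _ /mapP[k _ ->]; rewrite rootE -(p0 (fun i => x k ^+ (N ^ i))).
    rewrite horner_sum mevalE; apply/eqP/eq_bigr => m _.
    rewrite hornerZ hornerXn; congr (_ * _).
    rewrite /code -prodrXr; apply: eq_bigr => i _.
    by rewrite -exprM mulnC.
  - by rewrite map_inj_uniq ?iota_uniq.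
  - by rewrite size_map size_iota.
apply/mpolyP => m; rewrite mcoeff0.
have [mp|/memN_msupp_eq0 //] := boolP (m \in msupp p).
have : P`_(code m) = 0 by rewrite P0 coef0.
rewrite coef_sum (bigD1_seq m) ?msupp_uniq //= coefZ coefXn eqxx mulr1.
rewrite big_seq_cond big1 ?addr0 // => k /andP[kp neq_km].
rewrite coefZ coefXn; case: eqP => [eq_code|]; last by rewrite mulr0.
case/eqP: neq_km; apply/mnmP => i.
have lt_exp (k' : 'X_{1..n}) : k' \in msupp p -> forall j : 'I_n, (k' j < N)%N.
  move=> k'p j; apply: leq_ltn_trans (msize_mdeg_lt k'p).
  by rewrite mdegE (bigD1 j) //= leq_addr.
pose ext (k' : 'X_{1..n}) (j : nat) := (oapp k' 0 (insub j))%N.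
have extE (k' : 'X_{1..n}) (j : 'I_n) : ext k' j = k' j by rewrite /ext valK.
rewrite -!extE; apply: (@digits_inj N n) => //.
- by move=> j lt_jn; rewrite (extE k (Ordinal lt_jn)) lt_exp.
- by move=> j lt_jn; rewrite (extE m (Ordinal lt_jn)) lt_exp.
under eq_bigr do rewrite extE; under [RHS]eq_bigr do rewrite extE.
exact: esym.
Qed.

Lemma msizeM_leS (K : idomainType) n (p q : {mpoly K[n]}) a b :
  (msize p <= a.+1 -> msize q <= b.+1 -> msize (p * q) <= (a + b).+1)%N.
Proof.
move=> pa qb; have [->|p0] := eqVneq p 0; first by rewrite mul0r msize0.
have [->|q0] := eqVneq q 0; first by rewrite mulr0 msize0.
by rewrite msizeM //; lia.
Qed.

(** Count coefficients: the N ^ e products of powers less than N of the g i have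
    degree at most e * N * D, where D bounds the degrees of the g i, so they live
    in a space of dimension at most (C * N) ^ d with C independent of N. For N
    greater than C ^ d, the products outnumber this dimension since d < e, hence
    satisfy a nontrivial linear relation. *)
Lemma mpoly_dependent (K : fieldType) (d e : nat) (g : 'I_e -> {mpoly K[d]}) :
  (d < e)%N ->
  exists2 q : {mpoly K[e]}, q != 0 &
    forall v, q.@[fun i => (g i).@[v]] = 0.
Proof.
move=> lt_de; pose D := (\max_(i < e) msize (g i))%N.
pose C := (e * D).+1; pose N := (C ^ d).+1; pose B := (e * (N * D)).+1.
pose I := {ffun 'I_e -> 'I_N}; pose J := {ffun 'I_d -> 'I_B}.
have lt_card : (#|J| < #|I|)%N.
  rewrite !card_ffun !card_ord; apply: leq_ltn_trans (_ : (C * N) ^ d < _)%N.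
    have leB : (B <= C * N)%N.
      by rewrite /B /C mulSn [(N * D)%N]mulnC mulnA -add1n leq_add2r.
    by case: (d) => // k; rewrite leq_exp2r.
  rewrite expnMn (@leq_trans (N ^ d.+1)) ?leq_pexp2l // expnS ltn_pmul2r //.
  by rewrite expn_gt0.
pose mon n k (a : {ffun 'I_n -> 'I_k}) : 'X_{1..n} := [multinom a i : nat | i < n].
pose G (a : I) := \prod_(i < e) g i ^+ a i.
have sizeG a : (msize (G a) <= B)%N.
  suff H (s : seq 'I_e) : (msize (\prod_(i <- s) g i ^+ a i) <= (size s * (N * D)).+1)%N.
    by apply: leq_trans (H _) _; rewrite /index_enum -enumT size_enum_ord.
  elim: s => [|i s IHs]; first by rewrite big_nil msize1.
  rewrite big_cons mulSn; apply: msizeM_leS => //.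
  have H k : (msize (g i ^+ k) <= (k * D).+1)%N.
    elim: k => [|k IHk]; first by rewrite expr0 msize1.
    rewrite exprS mulSn; apply: msizeM_leS => //.
    by apply: leqW; apply: leq_bigmax.
  by apply: leq_trans (H _) _; rewrite ltnS leq_mul2r ltnW ?orbT.
pose M := \matrix_(a < #|I|, b < #|J|) (G (enum_val a))@_(mon _ _ (enum_val b)).
have /rowV0Pn[w /sub_kermxP wM w_n0] : kermx M != 0.
  rewrite kermx_eq0 /row_free neq_ltn (leq_ltn_trans _ lt_card) //.
  exact: rank_leq_col.
exists (\sum_a w 0 a *: 'X_[mon _ _ (enum_val a)]).
  apply: contraNneq w_n0 => q0; apply/eqP/rowP => a; rewrite mxE.
  have := congr1 (mcoeff (mon _ _ (enum_val a))) q0.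
  rewrite mcoeff0 raddf_sum (bigD1 a) //= mcoeffZ mcoeffX eqxx mulr1.
  rewrite big1 ?addr0 // => b neq_ba; rewrite mcoeffZ mcoeffX.
  case: eqP => [/mnmP eq_mon|]; last by rewrite mulr0.
  case/eqP: neq_ba; apply/enum_val_inj/ffunP => i; apply/val_inj.
  by have := eq_mon i; rewrite !mnmE.
move=> v; rewrite raddf_sum /=.
transitivity (\sum_a w 0 a *: G (enum_val a)).@[v].
  rewrite raddf_sum /=; apply: eq_bigr => a _.
  rewrite !mevalZ mevalX rmorph_prod /=; congr (_ * _).
  by apply: eq_bigr => i _; rewrite mnmE rmorphXn.
rewrite (_ : \sum_a _ = 0) ?meval0 //; apply/mpolyP => m; rewrite mcoeff0.
rewrite raddf_sum /=.
have [lt_mB|le_Bm] := ltnP (mdeg m) B; last first.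
  rewrite big1 // => a _; rewrite mcoeffZ memN_msupp_eq0 ?mulr0 //.
  by apply: msize_mdeg_ge; apply: leq_trans le_Bm.
have ltmB i : (m i < B)%N.
  by apply: leq_ltn_trans lt_mB; rewrite mdegE (bigD1 i) //= leq_addr.
pose b : J := [ffun i => Ordinal (ltmB i)].
have -> : m = mon _ _ b by apply/mnmP => i; rewrite mnmE ffunE.
have /rowP/(_ (enum_rank b)) := wM; rewrite !mxE => wMb.
apply: etrans wMb; apply: eq_bigr => a _.
by rewrite mcoeffZ mxE enum_rankK.
Qed.

(** * Dimension of a variety from a parametrization *)

Lemma polyfun_linear (K : fieldType) (V : vectType K) (l : {linear V -> K^o}) :
  exists p : {mpoly K[\dim {:V}]}, forall v, polyfun p v = l v.
Proof.
exists (\sum_(i < \dim {:V}) (l (vbasis {:V})`_i : K) *: 'X_i) => v.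
rewrite [in RHS](coord_vbasis (memvf v)) linear_sum /polyfun raddf_sum /=.
apply: eq_bigr => i _.
by rewrite mevalZ mevalXU linearZ /= mulrC.
Qed.

(** The map phi bounds the dimension from above: pulled back along it, functions
    on X become polynomials in d variables. The linear coordinates l bound it
    from below: a polynomial relation between them vanishes on all of K^d. *)
Lemma has_variety_dim_param (K : fieldType) (V : vectType K) (X : V -> Prop)
    (d : nat) (x : nat -> K) (phi : ('I_d -> K) -> V)
    (l : 'I_d -> {linear V -> K^o}) :
  injective x ->
  (forall i, exists P : {mpoly K[d]},
     forall t, coord (vbasis {:V}) i (phi t) = P.@[t]) ->
  (forall v, X v -> exists t, v = phi t) ->
  (forall t, exists2 v, X v & forall i, l i v = t i) ->
  has_variety_dim X d.
Proof.
move=> x_inj /fin_all_exists[P phiE] X_phi lX; split.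
  have [p pE] := fin_all_exists (fun i => polyfun_linear (l i)).
  exists p => q q0; apply: mpoly_vanish_eq0 x_inj _ => t.
  have [v Xv lv] := lX t; rewrite -(q0 v Xv); apply: meval_eq => i.
  by rewrite pE lv.
move=> e p p_indep; rewrite leqNgt; apply/negP => lt_de.
pose g i := p i \mPo [tuple P j | j < _].
have [q /eqP q_n0 qg] := mpoly_dependent g lt_de.
apply/q_n0/p_indep => v /X_phi[t ->]; rewrite -[RHS](qg t).
apply: meval_eq => i; rewrite comp_mpoly_meval; apply: meval_eq => j.
by rewrite tnth_mktuple phiE.
Qed.

(** * Functionals as matrices modulo the upper triangle *)

Section MatrixForms.
Variables (K : fieldType) (n : nat).
Local Notation g := (strictly_upper K n).
Local Notation gstar := 'Hom(subvs_of g, K^o).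
Implicit Types (u G H : 'M[K]_n).

Definition mxform G : gstar := linfun (fun x => \tr (G *m vsval x) : K^o).

Lemma mxformE G x : mxform G x = \tr (G *m vsval x).
Proof.
pose F (y : subvs_of g) : K^o := \tr (G *m vsval y).
have F_lin : linear F.
  move=> a y z; rewrite /F.
  have -> : vsval (a *: y + z) = a *: vsval y + vsval z by [].
  by rewrite mulmxDr -scalemxAr mxtraceD mxtraceZ.
pose Fl : {linear subvs_of g -> K^o} :=
  HB.pack F (GRing.isLinear.Build _ _ _ _ F F_lin).
exact: (lfunE Fl x).
Qed.

Definition eq_low G H := forall i j : 'I_n, (j < i)%N -> G i j = H i j.

Lemma mxform_eq_low G H : eq_low G H -> mxform G = mxform H.
Proof.
move=> eqGH; apply/lfunP => x; rewrite !mxformE /mxtrace.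
apply: eq_bigr => i _; rewrite !mxE; apply: eq_bigr => j _.
have [lt_ji|le_ij] := ltnP j i; first by rewrite eqGH.
by have /strictly_upperP-> := valP x; rewrite ?mulr0.
Qed.

Lemma mxform_delta G (i j : 'I_n) : (j < i)%N ->
  mxform G (vsproj g (delta_mx j i)) = G i j.
Proof.
move=> lt_ji; rewrite mxformE vsprojK; last first.
  apply/strictly_upperP => a b le_ba; rewrite mxE.
  case: andP => // -[/eqP eq_aj /eqP eq_bi].
  by move: le_ba; rewrite eq_aj eq_bi leqNgt lt_ji.
rewrite /mxtrace (bigD1 i) //= mxE (bigD1 j) //= mxE !eqxx mulr1.
rewrite big1 => [|k /negbTE neq_kj]; last by rewrite mxE neq_kj mulr0.
rewrite big1 => [|k /negbTE neq_ki]; first by rewrite !addr0.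
by rewrite mxE big1 // => m _; rewrite mxE neq_ki andbF mulr0.
Qed.

Lemma mxform_sum G : mxform G = \sum_i \sum_j G i j *: mxform (delta_mx i j).
Proof.
apply/lfunP => x; rewrite sum_lfunE mxformE {1}[G]matrix_sum_delta.
rewrite mulmx_suml raddf_sum; apply: eq_bigr => i _.
rewrite sum_lfunE mulmx_suml raddf_sum; apply: eq_bigr => j _.
by rewrite scale_lfunE mxformE -scalemxAl /= mxtraceZ.
Qed.

(** Induction from the last row upwards: row i of u *m invmx u expresses row i of
    invmx u through the later rows. *)
Lemma unitriangular_inv u : unitriangular u -> unitriangular (invmx u).
Proof.
move=> uu i j; have [m le_m] := ubnP (n - i); elim: m => // m IHm in i le_m *.
move=> le_ji; have /matrixP/(_ i j) := mulmxV (unitriangular_unit uu).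
rewrite !mxE (bigD1 i) //= uu // eqxx mul1r big1 ?addr0 // => k neq_ki.
have [le_ki|lt_ik] := leqP k i.
  by rewrite uu // eq_sym (negbTE neq_ki) mul0r.
have lt_jk := leq_ltn_trans le_ji lt_ik.
rewrite IHm ?(ltnW lt_jk) //; last by have := ltn_ord k; lia.
by rewrite -val_eqE gtn_eqF ?mulr0.
Qed.

Lemma unitriangular_mul u v :
  unitriangular u -> unitriangular v -> unitriangular (u *m v).
Proof.
move=> uu vv i j le_ji; rewrite mxE (bigD1 i) //= uu // eqxx mul1r vv //.
rewrite big1 ?addr0 // => k neq_ki; have [le_ki|lt_ik] := leqP k i.
  by rewrite uu // eq_sym (negbTE neq_ki) mul0r.
have lt_jk := leq_ltn_trans le_ji lt_ik.
by rewrite vv ?(ltnW lt_jk) // -val_eqE gtn_eqF ?mulr0.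
Qed.

Lemma coadjoint_mxform u G : unitriangular u ->
  coadjoint u (mxform G) = mxform (u *m G *m invmx u).
Proof.
move=> uu; apply/lfunP => x; rewrite coadjointE !mxformE.
rewrite vsprojK; last by apply: conj_strictly_upper => //; apply: valP.
by rewrite mulmxA mxtrace_mulC !mulmxA.
Qed.

End MatrixForms.

(** * Orbits of nested rook placements *)

Section NestedRooks.
Variables (K : fieldType) (n r : nat) (s c : 'I_r -> 'I_n).
Hypothesis s_incr : forall k l : 'I_r, (k < l)%N -> (s k < s l)%N.
Hypothesis c_decr : forall k l : 'I_r, (k < l)%N -> (c l < c k)%N.
Hypothesis lt_sc : forall k, (s k < c k)%N.
Implicit Types (A : 'M[K]_(n, r)) (B : 'M[K]_(r, n)) (u : 'M[K]_n).

Lemma s_inj : injective s.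
Proof.
move=> k l eq_s; apply/val_inj.
by case: (ltngtP k l) => // /s_incr; rewrite eq_s ltnn.
Qed.

Lemma c_inj : injective c.
Proof.
move=> k l eq_c; apply/val_inj.
by case: (ltngtP k l) => // /c_decr; rewrite eq_c ltnn.
Qed.

Definition cols_end_at A := forall (i : 'I_n) (k : 'I_r), (c k <= i)%N -> A i k = (i == c k)%:R.
Definition rows_start_at B := forall (k : 'I_r) (j : 'I_n), (j <= s k)%N -> B k j = (j == s k)%:R.

Definition rook_cols : 'M[K]_(n, r) := \matrix_(i, k) (i == c k)%:R.
Definition rook_rows : 'M[K]_(r, n) := \matrix_(k, j) (j == s k)%:R.
Definition rook_form := mxform (rook_cols *m rook_rows).

Lemma mul_rook_cols u i k : (u *m rook_cols) i k = u i (c k).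
Proof.
rewrite mxE (bigD1 (c k)) //= mxE eqxx mulr1 big1 ?addr0 // => j /negbTE neq.
by rewrite mxE neq mulr0.
Qed.

Lemma mul_rook_rows u k j : (rook_rows *m u) k j = u (s k) j.
Proof.
rewrite mxE (bigD1 (s k)) //= mxE eqxx mul1r big1 ?addr0 // => i /negbTE neq.
by rewrite mxE neq mul0r.
Qed.

Lemma cols_end_at_rook_cols u : unitriangular u -> cols_end_at (u *m rook_cols).
Proof. by move=> uu i k le_ci; rewrite mul_rook_cols uu. Qed.

Lemma rows_start_at_mul B u : rows_start_at B -> unitriangular u -> rows_start_at (B *m u).
Proof.
move=> Bs uu k j le_js; rewrite mxE (bigD1 (s k)) //= Bs // eqxx mul1r uu //.
rewrite [s k == j]eq_sym big1 ?addr0 // => i neq_i.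
have [le_is|lt_si] := leqP i (s k); first by rewrite Bs // (negbTE neq_i) mul0r.
have lt_ji := leq_ltn_trans le_js lt_si.
by rewrite uu ?(ltnW lt_ji) // -val_eqE gtn_eqF ?mulr0.
Qed.

Lemma rows_start_at_rook_rows : rows_start_at rook_rows.
Proof. by move=> k j _; rewrite mxE. Qed.

(** The matrix u is the identity with column c k replaced by column k of A. *)
Lemma cols_end_at_unitriangular A : cols_end_at A ->
  exists2 u, unitriangular u & A = u *m rook_cols.
Proof.
move=> Ac.
exists (\matrix_(i, j) if [pick k | c k == j] is Some k then A i k
                       else (i == j)%:R).
  move=> i j le_ji; rewrite mxE; case: pickP => // k /eqP ck.
  by rewrite -ck in le_ji *; apply: Ac.
apply/matrixP => i k; rewrite mul_rook_cols mxE.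
by case: pickP => [l /eqP/c_inj-> //|/(_ k)]; rewrite eqxx.
Qed.

(** The matrix u is the identity with row s k replaced by row k of B. It perturbs
    column c k of the identity only at the rows s l with B l (c k) nonzero, which
    forces c k < c l, hence l < k and s l < s k. In the product with rook_rows
    the perturbation lands at (s l, s k), above the diagonal. *)
Lemma rows_start_at_unitriangular B : rows_start_at B ->
    (forall (k : 'I_r) (j : 'I_n), (c k <= j)%N -> B k j = 0) ->
  exists u, [/\ unitriangular u, B = rook_rows *m u &
    eq_low (u *m rook_cols *m rook_rows) (rook_cols *m rook_rows)].
Proof.
move=> Bs B0.
pose u : 'M[K]_n := \matrix_(i, j) if [pick k | s k == i] is Some k then B k j
                                   else (i == j)%:R.
have uE k j : u (s k) j = B k j.
  by rewrite mxE; case: pickP => [l /eqP/s_inj-> //|/(_ k)]; rewrite eqxx.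
exists u; split.
- move=> i j le_ji; rewrite mxE; case: pickP => // k /eqP sk.
  by rewrite -sk in le_ji *; rewrite Bs // eq_sym.
- by apply/matrixP => k j; rewrite mul_rook_rows uE.
move=> i j lt_ji; rewrite !mxE; apply: eq_bigr => k _.
rewrite mul_rook_cols !mxE; case: (eqVneq j (s k)) => [ejk|]; rewrite ?mulr0 //.
case: pickP => // l /eqP sl; rewrite -sl ejk in lt_ji *.
have lt_kl : (k < l)%N.
  by case: (ltngtP l k) lt_ji => // [/s_incr|/val_inj->]; rewrite ?ltnn //; lia.
rewrite B0 ?(ltnW (c_decr lt_kl)) // (_ : (s l == c k) = false) //.
by apply/negbTE; rewrite -val_eqE neq_ltn (ltn_trans (lt_sc l)) ?c_decr.
Qed.

(** For transitivity, write A as v *m rook_cols; conjugating by the inverse of v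
    moves v into B. Row k of B is then row c k of the product rook_cols *m B, so
    its entries from column c k on lie on or above the diagonal and can be
    erased; rows_start_at_unitriangular conjugates what is left to the rook
    matrix modulo the upper triangle. *)
Lemma rook_orbit_factor (f : 'Hom(subvs_of (strictly_upper K n), K^o)) :
  coadjoint_orbit rook_form f <->
  exists A B, [/\ cols_end_at A, rows_start_at B & f = mxform (A *m B)].
Proof.
split=> [[u uu ->]|[A [B [Ac Bs ->]]]].
  exists (u *m rook_cols), (rook_rows *m invmx u); split.
  - exact: cols_end_at_rook_cols.
  - exact: rows_start_at_mul rows_start_at_rook_rows (unitriangular_inv uu).
  - by rewrite coadjoint_mxform // !mulmxA.
have [v vv ->] := cols_end_at_unitriangular Ac.
pose B1 := B *m v; have B1s : rows_start_at B1 by apply: rows_start_at_mul.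
pose B2 : 'M[K]_(r, n) := \matrix_(k, j) if (j < c k)%N then B1 k j else 0.
have B2s : rows_start_at B2.
  by move=> k j le_js; rewrite mxE (leq_ltn_trans le_js) // B1s.
have [|u [uu B2E low_u]] := rows_start_at_unitriangular B2s.
  by move=> k j le_cj; rewrite mxE ltnNge le_cj.
have uU := unitriangular_unit uu; have vU := unitriangular_unit vv.
have ww : unitriangular (v *m invmx u).
  exact: unitriangular_mul (unitriangular_inv uu).
exists (v *m invmx u) => //.
transitivity (coadjoint v (mxform (rook_cols *m B1))).
  by rewrite coadjoint_mxform // /B1 !mulmxA mulmxK.
have -> : mxform (rook_cols *m B1) = mxform (rook_cols *m B2).
  apply: mxform_eq_low => i j lt_ji; rewrite !mxE; apply: eq_bigr => k _.
  rewrite !mxE; case: eqP => [eq_ik|_]; last by rewrite !mul0r.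
  by rewrite -eq_ik lt_ji.
rewrite /rook_form -(mxform_eq_low low_u) !coadjoint_mxform //.
congr mxform; apply: (canRL (mulmxK (unitriangular_unit ww))).
by rewrite B2E !mulmxA !mulmxKV // mulmxK.
Qed.

Definition rook_index := {ki : 'I_r * 'I_n | s ki.1 < ki.2 < c ki.1}%N.

Lemma card_rook_index : #|{: rook_index}| = (\sum_k (c k - s k).-1)%N.
Proof.
rewrite card_sig -sum1_card.
rewrite -(pair_big_dep xpredT (fun k (i : 'I_n) => s k < i < c k)%N (fun _ _ => 1%N)) /=.
apply: eq_bigr => k _; rewrite -(big_mkord (fun i => s k < i < c k)%N (fun _ => 1%N)).
rewrite (big_cat_nat _ (n := (s k).+1)) //= ?ltn_ord // [X in (X + _)%N]big_nat_cond.
rewrite big_pred0 ?add0n; last by move=> i; lia.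
rewrite (big_cat_nat _ (n := c k)) //=; last exact: ltnW.
rewrite [X in (_ + X)%N]big_nat_cond [X in (_ + X)%N]big_pred0 ?addn0; last by move=> i; lia.
rewrite big_nat_cond (eq_bigl (fun i => (s k).+1 <= i < c k)%N); last by move=> i; lia.
by rewrite -big_nat sum_nat_const_nat muln1; lia.
Qed.

Definition rook_param := (bool * rook_index)%type.

(** The boolean is false for the entries of A and true for those of B; i0 is the
    position of the pivot 1, and t supplies the entries strictly between s k and
    c k. *)
Definition param_entry (t : rook_param -> K) (b : bool) (k : 'I_r) (i : 'I_n)
    (i0 : 'I_n) : K :=
  if insub (k, i) is Some x then t (b, x) else (i == i0)%:R.

Definition param_cols t : 'M[K]_(n, r) := \matrix_(i, k) param_entry t false k i (c k).
Definition param_rows t : 'M[K]_(r, n) := \matrix_(k, j) param_entry t true k j (s k).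

(** Below the diagonal, a nonzero summand A i k * B k j has s k <= j < i <= c k,
    so it only sees pivots and free entries. *)
Lemma factor_param A B : cols_end_at A -> rows_start_at B ->
  exists t, mxform (A *m B) = mxform (param_cols t *m param_rows t).
Proof.
move=> Ac Bs.
exists (fun bx => if bx.1 then B (val bx.2).1 (val bx.2).2
                  else A (val bx.2).2 (val bx.2).1).
apply: mxform_eq_low => i j lt_ji; rewrite !mxE; apply: eq_bigr => k _.
rewrite !mxE /param_entry.
case: (ltngtP i (c k)) => [lt_ic|lt_ci|/val_inj eq_ic].
- case: (ltngtP j (s k)) => [lt_js|lt_sj|/val_inj eq_js].
  + rewrite Bs ?(ltnW lt_js) // [insub (k, j)]insubF /=; last by lia.
    by rewrite -val_eqE ltn_eqF // !mulr0.
  + have lt_si := ltn_trans lt_sj lt_ji; have lt_jc := ltn_trans lt_ji lt_ic.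
    by rewrite !insubT /= ?lt_si ?lt_sj.
  + rewrite eq_js in lt_ji *; rewrite Bs // insubT /= ?lt_ji //.
    by rewrite insubF ?eqxx //= ltnn.
- rewrite Ac ?(ltnW lt_ci) // insubF /=; last by lia.
  by rewrite -val_eqE gtn_eqF // !mul0r.
rewrite eq_ic in lt_ji *; rewrite Ac // [insub (k, c k)]insubF /=; last by lia.
rewrite eqxx !mul1r.
case: (ltngtP j (s k)) => [lt_js|lt_sj|/val_inj eq_js].
- by rewrite Bs ?(ltnW lt_js) // insubF //=; lia.
- by rewrite insubT /= ?lt_sj.
by rewrite eq_js Bs // insubF //= ltnn.
Qed.

(** The free entries of column k of A and of row k of B appear linearly, with
    coefficient 1, in the prescribed entries of A *m B, with correction terms
    that involve only indices less than k. *)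
Lemma rook_coords_onto (t : rook_param -> K) :
  exists A B, [/\ cols_end_at A, rows_start_at B &
    forall x : rook_index,
      (A *m B) (val x).2 (s (val x).1) = t (false, x) /\
      (A *m B) (c (val x).1) (val x).2 = t (true, x)].
Proof.
suff upto q : (q <= r)%N -> exists A B, [/\ cols_end_at A, rows_start_at B &
    forall x : rook_index, ((val x).1 < q)%N ->
      (A *m B) (val x).2 (s (val x).1) = t (false, x) /\
      (A *m B) (c (val x).1) (val x).2 = t (true, x)].
  have [A [B [Ac Bs AB]]] := upto r (leqnn r).
  by exists A, B; split=> // x; apply: AB.
(* In an entry of A *m B whose column is s k, or whose row is c k, the summands
   after k vanish and the k-th one is a bare entry of A or of B; hence column k
   of A and row k of B can be solved for once the earlier ones are known. *)
have cutL (A : 'M[K]_(n, r)) B (k : 'I_r) (i : 'I_n) : rows_start_at B -> (A *m B) i (s k) =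
    \sum_(l < r | (l < k)%N) A i l * B l (s k) + A i k.
  move=> Bs; rewrite mxE (bigID (fun l : 'I_r => (l < k)%N)) /=; congr (_ + _).
  rewrite (bigD1 k) ?ltnn //= Bs // eqxx mulr1 big1 ?addr0 // => l.
  case/andP=> le_kl neq_lk; have lt_kl : (k < l)%N by move: neq_lk; rewrite -val_eqE /=; lia.
  have lt_s := s_incr lt_kl.
  by rewrite Bs ?(ltnW lt_s) // -val_eqE ltn_eqF ?mulr0.
have cutR A (B : 'M[K]_(r, n)) (k : 'I_r) (j : 'I_n) : cols_end_at A -> (A *m B) (c k) j =
    \sum_(l < r | (l < k)%N) A (c k) l * B l j + B k j.
  move=> Ac; rewrite mxE (bigID (fun l : 'I_r => (l < k)%N)) /=; congr (_ + _).
  rewrite (bigD1 k) ?ltnn //= Ac // eqxx mul1r big1 ?addr0 // => l.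
  case/andP=> le_kl neq_lk; have lt_kl : (k < l)%N by move: neq_lk; rewrite -val_eqE /=; lia.
  have lt_c := c_decr lt_kl.
  by rewrite Ac ?(ltnW lt_c) // -val_eqE gtn_eqF ?mul0r.
elim: q => [|q IHq] lt_qr.
  by exists rook_cols, rook_rows; split=> // i k _; rewrite mxE.
have [A [B [Ac Bs AB]]] := IHq (ltnW lt_qr); pose k := Ordinal lt_qr.
pose A' : 'M[K]_(n, r) := \matrix_(i, l)
  if l == k then
    if insub (k, i) is Some x then
      t (false, x) - \sum_(m < r | (m < k)%N) A i m * B m (s k)
    else (i == c k)%:R
  else A i l.
pose B' : 'M[K]_(r, n) := \matrix_(l, j)
  if l == k then
    if insub (k, j) is Some x then
      t (true, x) - \sum_(m < r | (m < k)%N) A (c k) m * B m j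
    else (j == s k)%:R
  else B l j.
have A'c : cols_end_at A'.
  move=> i l; rewrite mxE; case: eqP => [->|_ /Ac //] le_ci.
  by rewrite insubF //=; lia.
have B's : rows_start_at B'.
  move=> l j; rewrite mxE; case: eqP => [->|_ /Bs //] le_js.
  by rewrite insubF //=; lia.
have A'E i (m : 'I_r) : (m < k)%N -> A' i m = A i m.
  by move=> lt_mk; rewrite mxE -val_eqE ltn_eqF.
have B'E j (m : 'I_r) : (m < k)%N -> B' m j = B m j.
  by move=> lt_mk; rewrite mxE -val_eqE ltn_eqF.
exists A', B'; split=> // x; rewrite ltnS leq_eqVlt cutL // cutR //.
case/predU1P=> [eq_xq|lt_xk].
  have eq_xk : (val x).1 = k by apply: val_inj.
  case: x eq_xk {eq_xq} => -[k' i] /= ki eq_k; rewrite {k'}eq_k in ki *.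
  split.
    rewrite [A' i k]mxE eqxx insubT /=.
    rewrite (eq_bigr (fun m => A i m * B m (s k))) => [|m lt_mk]; last by rewrite A'E ?B'E.
    by rewrite addrC subrK; congr t; congr pair; apply: val_inj.
  rewrite [B' k i]mxE eqxx insubT /=.
  rewrite (eq_bigr (fun m => A (c k) m * B m i)) => [|m lt_mk]; last by rewrite A'E ?B'E.
  by rewrite addrC subrK; congr t; congr pair; apply: val_inj.
have [<- <-] := AB x lt_xk; rewrite cutL // cutR // A'E // B'E //.
by split; congr (_ + _); apply: eq_bigr => m lt_m; rewrite A'E ?B'E ?(ltn_trans lt_m).
Qed.

(** Each rook has an arm of c k - s k - 1 free entries in A and another one in B;
    the parametrization and the coordinates of the orbit are both indexed by
    these entries. *)
Theorem rook_orbit_dim (x : nat -> K) : injective x ->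
  has_variety_dim (coadjoint_orbit rook_form) (2 * \sum_k (c k - s k).-1).
Proof.
move=> x_inj.
have <- : #|{: rook_param}| = (2 * \sum_k (c k - s k).-1)%N.
  by rewrite card_prod card_bool card_rook_index.
pose phi (t : 'I_#|{: rook_param}| -> K) :=
  let t' y := t (enum_rank y) in mxform (param_cols t' *m param_rows t').
pose coo (y : rook_param) : 'I_n * 'I_n :=
  let: (k, i) := val y.2 in if y.1 then (c k, i) else (i, s k).
have lt_coo y : ((coo y).2 < (coo y).1)%N.
  by case: y => -[] [[k i] /= /andP[]].
pose evl y (f : 'Hom(subvs_of (strictly_upper K n), K^o)) : K^o :=
  f (vsproj _ (delta_mx (coo y).2 (coo y).1)).
have evl_lin y : linear (evl y).
  by move=> a f h; rewrite /evl add_lfunE scale_lfunE.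
pose l (i : 'I_#|{: rook_param}|) : {linear 'Hom(subvs_of (strictly_upper K n), K^o) -> K^o} :=
  HB.pack (evl (enum_val i)) (GRing.isLinear.Build _ _ _ _ _ (evl_lin (enum_val i))).
apply: (has_variety_dim_param (phi := phi) (l := l) x_inj).
- move=> b.
  pose P (bb : bool) k (i i0 : 'I_n) : {mpoly K[#|{: rook_param}|]} :=
    if insub (k, i) is Some y then 'X_(enum_rank (bb, y)) else (i == i0)%:R%:MP.
  have PE t bb k i i0 : (P bb k i i0).@[t] =
      param_entry (fun y => t (enum_rank y)) bb k i i0.
    by rewrite /P /param_entry; case: insub => [y|]; rewrite ?mevalXU ?mevalC.
  exists (\sum_i \sum_j (\sum_k P false k i (c k) * P true k j (s k)) *
            (coord (vbasis fullv) b (mxform (delta_mx i j)))%:MP) => t.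
  rewrite /phi mxform_sum !linear_sum /=; apply: eq_bigr => i _.
  rewrite !linear_sum /=; apply: eq_bigr => j _.
  rewrite linearZ mevalM mevalC /=; congr (_ * _).
  rewrite mxE linear_sum /=; apply: eq_bigr => k _.
  by rewrite mevalM !PE !mxE.
- move=> f /rook_orbit_factor[A [B [Ac Bs ->]]].
  have [t ->] := factor_param Ac Bs.
  exists (fun i => t (enum_val i)); rewrite /phi.
  by congr mxform; congr (_ *m _); apply/matrixP => i k; rewrite !mxE;
    rewrite /param_entry; case: insub => // y; rewrite enum_rankK.
move=> t; have [A [B [Ac Bs AB]]] := rook_coords_onto (fun y => t (enum_rank y)).
exists (mxform (A *m B)); first by apply/rook_orbit_factor; exists A, B.
move=> i /=; rewrite /evl mxform_delta //.
rewrite -[in RHS](enum_valK i); case: (enum_val i) => b y.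
by rewrite /coo; case: y (AB y) => -[k j] kj []; case: b.
Qed.
End NestedRooks.

(** * Reaching every half dimension *)

(** The q outermost rooks of a full antidiagonal have arms of lengths n - 2, n - 4,
    ..., with sum q * (n - 1 - q); h is the arm length of one more rook inside
    them, which can be anything up to n - 2 - 2 * q. *)
Lemma layer_decomposition (n m : nat) : (1 < n)%N -> (4 * m <= (n - 1) ^ 2)%N ->
  exists q h, (m = q * (n - 1 - q) + h)%N /\ (2 * q + 2 + h <= n)%N.
Proof.
move=> n_gt1; elim: m => [|m IHm] le_m; first by exists 0%N, 0%N; split; lia.
have [|q [h [mE le_n]]] := IHm; first by lia.
have [lt_n|] := ltnP (2 * q + 2 + h) n; first by exists q, h.+1; split; lia.
move=> ge_n; have {}le_n : n = (2 * q + 2 + h)%N by apply/eqP; rewrite eqn_leq le_n ge_n.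
have [le_q|lt_q] := leqP (2 * q.+1 + 3) n.
  by exists q.+1, 1%N; split; [subst n; nia|lia].
have [h0|h1|h2] : [\/ h = 0, h = 1 | h = 2]%N.
  by case: (h) le_n lt_q => [|[|[|k]]] *; [constructor 1|constructor 2|constructor 3|lia].
all: subst n h; nia.
Qed.

Lemma exists_nested_rooks (n m : nat) : (0 < n)%N -> (4 * m <= (n - 1) ^ 2)%N ->
  exists r (s c : 'I_r -> 'I_n),
    [/\ forall k l : 'I_r, (k < l)%N -> (s k < s l)%N,
        forall k l : 'I_r, (k < l)%N -> (c l < c k)%N,
        forall k, (s k < c k)%N & (\sum_k (c k - s k).-1 = m)%N].
Proof.
case: n => // n _; case: (posnP n) => [->|n_gt0] le_m.
  have s (k : 'I_0) : 'I_1 by case: k.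
  exists 0%N, s, s; split; try by case.
  by rewrite big_ord0; lia.
have [//|q [h [mE le_n]]] := layer_decomposition _ le_m.
(* The order n is now n.+1, so the antidiagonal rook in column k is in row n - k. *)
pose s (k : 'I_q.+1) : 'I_n.+1 := inord k.
pose c (k : 'I_q.+1) : 'I_n.+1 := inord (if k < q then n - k else q.+1 + h)%N.
have sE k : s k = k :> nat by rewrite inordK //; have := ltn_ord k; lia.
have cE k : c k = (if k < q then n - k else q.+1 + h)%N :> nat.
  by rewrite inordK //; case: ifP; lia.
exists q.+1, s, c; split.
- by move=> k l; rewrite !sE.
- by move=> k l lt_kl; have := ltn_ord l; rewrite !cE; do 2?case: ifP; lia.
- by move=> k; have := ltn_ord k; rewrite sE cE; case: ifP; lia.
rewrite big_ord_recr /= sE cE ltnn mE; congr (_ + _)%N; last by rewrite /=; lia.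
rewrite (eq_bigr (fun k : 'I_q => n - k.*2.+1)%N) => [|k _]; last first.
  by rewrite sE cE /= ltn_ord; lia.
elim: q le_n {s c sE cE mE} => [|q IHq] le_n; first by rewrite big_ord0.
by rewrite big_ord_recr IHq /=; nia.
Qed.

Lemma exists_orbit_dim (K : fieldType) (x : nat -> K) (n m : nat) :
  injective x -> (0 < n)%N -> (4 * m <= (n - 1) ^ 2)%N ->
  exists f : 'Hom(subvs_of (strictly_upper K n), K^o),
    has_variety_dim (coadjoint_orbit f) (2 * m).
Proof.
move=> x_inj n_gt0 /(exists_nested_rooks n_gt0)[r [s [c [s_incr c_decr lt_sc <-]]]].
by exists (rook_form K s c); apply: rook_orbit_dim x_inj.
Qed.

Theorem theorem7p4 (R : realType) (n : nat) (n_gt0 : (0 < n)%N) :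
  (~~ odd n -> forall m : nat, (m <= ((n - 2) * n) %/ 4)%N ->
     exists f : 'Hom(subvs_of (strictly_upper R[i] n), R[i]^o),
       has_variety_dim (coadjoint_orbit f) (2 * m)) /\
  (odd n -> forall m : nat, (m <= ((n - 1) ^ 2) %/ 4)%N ->
     exists f : 'Hom(subvs_of (strictly_upper R[i] n), R[i]^o),
       has_variety_dim (coadjoint_orbit f) (2 * m)).
Proof.
have natr_inj : injective (fun k => k%:R : R[i]).
  by move=> k l /eqP; rewrite Num.Theory.eqr_nat => /eqP.
split=> _ m le_m; apply: (exists_orbit_dim natr_inj n_gt0).
  by apply: leq_trans (_ : (n - 2) * n <= _)%N; nia.
by lia.
Qed.
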